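(* (Progress.) For all well-typed terms $M$ (i.e. $\Gamma\vdash M:A$ for some $\Gamma$, $A$), either $M$ is in normal form, or there is a term $M'$ with $M\leadsto M'$.
   Context: The language is a typed lambda calculus with intensional type analysis, records, lists, database tables and traces. Everything is up to renaming of bound variables; substitution is capture-avoiding. **Kinds and constructors.** $K ::= \mathit{Type} \mid \mathit{Row} \mid K_1\to K_2$. Constructors $C,D ::= \mathtt{Bool}^* \mid \mathtt{Int}^* \mid \mathtt{String}^* \mid \alpha \mid \lambda\alpha{:}K.C \mid C\,D \mid \mathtt{List}^*C \mid \mathtt{Record}^*S \mid \mathtt{Trace}^*C \mid \mathbf{Typerec}\ C\ (C_B,C_I,C_S,C_L,C_R,C_T)$. Row constructors $S ::= \cdot \mid l:C;S \mid \rho \mid \mathbf{Rmap}\ C\ S$. Type variables of kind $\mathit{Row}$ are written $\rho$; arguments of applications may also be row constructors. Kinding: variables, abstraction, application as in the simply typed lambda calculus; base constructors have kind $\mathit{Type}$; $\mathtt{List}^*C,\mathtt{Trace}^*C:\mathit{Type}$ if $C:\mathit{Type}$; $\mathtt{Record}^*S:\mathit{Type}$ if $S:\mathit{Row}$; for any kind $K$, $\mathbf{Typerec}\,C\,(C_B,C_I,C_S,C_L,C_R,C_T):K$ if $C:\mathit{Type}$, $C_B,C_I,C_S:K$, $C_L,C_T:\mathit{Type}\to K\to K$, $C_R:\mathit{Row}\to\mathit{Row}\to K$; $\cdot:\mathit{Row}$; $(l:C;S):\mathit{Row}$ if $C:\mathit{Type}$, $S:\mathit{Row}$; $\mathbf{Rmap}\,C\,S:\mathit{Row}$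 if $C:\mathit{Type}\to\mathit{Type}$, $S:\mathit{Row}$. Constructor reduction $\leadsto$ is closed under reduction in any immediate sub(row)constructor and has the rules (with $\vec C=(C_B,C_I,C_S,C_L,C_R,C_T)$): $(\lambda\alpha{:}K.C)\,D\leadsto C[\alpha:=D]$; $\mathbf{Rmap}\,C\,\cdot\leadsto\cdot$; $\mathbf{Rmap}\,C\,(l:D;S)\leadsto(l:C\,D;\mathbf{Rmap}\,C\,S)$; $\mathbf{Typerec}\,\mathtt{Bool}^*\vec C\leadsto C_B$; $\mathbf{Typerec}\,\mathtt{Int}^*\vec C\leadsto C_I$; $\mathbf{Typerec}\,\mathtt{String}^*\vec C\leadsto C_S$; $\mathbf{Typerec}\,(\mathtt{List}^*D)\,\vec C\leadsto C_L\,D\,(\mathbf{Typerec}\,D\,\vec C)$; $\mathbf{Typerec}\,(\mathtt{Record}^*S)\,\vec C\leadsto C_R\,S\,(\mathbf{Rmap}\,(\lambda\alpha.\mathbf{Typerec}\,\alpha\,\vec C)\,S)$; $\mathbf{Typerec}\,(\mathtt{Trace}^*D)\,\vec C\leadsto C_T\,D\,(\mathbf{Typerec}\,D\,\vec C)$. Constructor equivalence $\Gamma\vdash C=D:K$ (and likewise for rows) is the least congruent equivalence relation on well-kinded (row) constructors such that $C=D:K$ whenever $C:K$, $D:K$ and $C\leadsto D$, and containing $\eta$: $\lambda\alpha{:}K.C\,\alpha = C$. **Types.** $A,B ::= \mathtt{T}(C)\mid\mathtt{Bool}\mid\mathtt{Int}\mid\mathtt{String}\mid A\to B\mid\mathtt{List}\,A\mid\mathtt{Record}\,R\mid\mathtt{Trace}\,A\mid\forall\alpha{:}K.A$,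 rows $R::=\cdot\mid l:A;R\mid\mathtt{T}(S)$, with the evident kinding. Type/row equivalence $\Gamma\vdash A=B$ is the least congruent equivalence relation with $\mathtt{T}(C)=\mathtt{T}(D)$ when $C=D:\mathit{Type}$, $\mathtt{T}(S)=\mathtt{T}(S')$ when $S=S':\mathit{Row}$, and $\mathtt{T}(\mathtt{Bool}^* )=\mathtt{Bool}$, $\mathtt{T}(\mathtt{Int}^* )=\mathtt{Int}$, $\mathtt{T}(\mathtt{String}^* )=\mathtt{String}$, $\mathtt{T}(\mathtt{List}^*C)=\mathtt{List}\,\mathtt{T}(C)$, $\mathtt{T}(\mathtt{Record}^*S)=\mathtt{Record}\,\mathtt{T}(S)$, $\mathtt{T}(\mathtt{Trace}^*C)=\mathtt{Trace}\,\mathtt{T}(C)$, $\mathtt{T}(\cdot)=\cdot$, $\mathtt{T}(l:C;S)=(l:\mathtt{T}(C);\mathtt{T}(S))$. We write $[A]$ for $\mathtt{List}\,A$, $\langle R\rangle$ for $\mathtt{Record}\,R$ and often omit stars. Contexts list distinct variables $\alpha:K$ and $x:A$ with $A:\mathit{Type}$. **Terms and typing** ($\Gamma\vdash M:A$). Constants $c$ (the Boolean ones being $\mathbf{true},\mathbf{false}$) have their base type; variables, $\lambda x{:}A.M$ (with $A:\mathit{Type}$), application as usual; $\Lambda\alpha{:}K.M:\forall\alpha{:}K.A$ if $\Gamma,\alpha:K\vdash M:A$; $M\,C:A[\alpha:=C]$ if $M:\forall\alpha{:}K.A$, $C:K$; $\mathbf{fix}\,f{:}A.M:A$ if $A$ is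 well-kinded and $\Gamma,f:A\vdash M:A$; $\mathbf{if}\ L\ \mathbf{then}\ M\ \mathbf{else}\ N:A$ if $L:\mathtt{Bool}$, $M,N:A$; $M+N:\mathtt{Int}$ if $M,N:\mathtt{Int}$; $M==N:\mathtt{Bool}$ if $M,N:A$ and $A:\mathit{Type}$; $\langle\rangle:\langle\cdot\rangle$; $\langle l=M;N\rangle:\langle l:A;R\rangle$ if $M:A$ and $N:\langle R\rangle$ (and $\langle\overline{l_i=M_i}\rangle$ abbreviates an iterated extension of $\langle\rangle$); $M.l:A$ if $M:\langle l:A;R\rangle$; $[]:[A]$ if $A:\mathit{Type}$; $[M]:[A]$ if $M:A$; $M\mathbin{+\!\!+}N:[A]$ if $M,N:[A]$; $\mathbf{for}\,(x\leftarrow M)\,N:[B]$ if $M:[A]$ and $\Gamma,x:A\vdash N:[B]$; $\mathbf{table}\ n\ \langle\mathsf{oid}:\mathtt{Int};R\rangle:[\langle\mathsf{oid}:\mathtt{Int};R\rangle]$ where $R$ is a closed row of fields of base types; conversion: $M:A$ if $M:B$ and $\Gamma\vdash A=B$. $\mathbf{rmap}^S\,M\,N:\mathtt{T}(\mathtt{Record}^*(\mathbf{Rmap}\,C\,S))$ if $M:\forall\alpha{:}\mathit{Type}.\mathtt{T}(\alpha)\to\mathtt{T}(C\,\alpha)$ and $N:\mathtt{T}(\mathtt{Record}^*S)$. $\mathbf{rfold}^S\,L\,M\,N:\mathtt{T}(C)$ if $L:\mathtt{T}(C)\to\mathtt{T}(C)\to\mathtt{T}(C)$, $M:\mathtt{T}(C)$,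 $N:\mathtt{T}(\mathtt{Record}^*(\mathbf{Rmap}\,(\lambda\alpha.C)\,S))$. $\mathbf{typecase}\ C\ \mathbf{of}\,(M_B,M_I,M_S,\beta.M_L,\rho.M_R,\gamma.M_T):B[\alpha:=C]$ if $C:\mathit{Type}$, $\Gamma,\alpha:\mathit{Type}\vdash B:\mathit{Type}$, $\beta,\rho,\gamma\notin\mathrm{Dom}(\Gamma)$, $M_B:B[\alpha:=\mathtt{Bool}^*]$, $M_I:B[\alpha:=\mathtt{Int}^*]$, $M_S:B[\alpha:=\mathtt{String}^*]$, $\Gamma,\beta:\mathit{Type}\vdash M_L:B[\alpha:=\mathtt{List}^*\beta]$, $\Gamma,\rho:\mathit{Row}\vdash M_R:B[\alpha:=\mathtt{Record}^*\rho]$, $\Gamma,\gamma:\mathit{Type}\vdash M_T:B[\alpha:=\mathtt{Trace}^*\gamma]$. With $\mathtt{TRACE}=\lambda a{:}\mathit{Type}.\mathbf{Typerec}\ a\ (\mathtt{Trace\ Bool},\mathtt{Trace\ Int},\mathtt{Trace\ String},\lambda e\,e'.\mathtt{List}\,e',\lambda r\,r'.\mathtt{Record}\,r',\lambda b\,t.t)$: $\mathtt{Lit}\,c:\mathtt{Trace}\,O$ if $c:O$, $O$ a base type ($\mathtt{Bool},\mathtt{Int},\mathtt{String}$); $\mathtt{If}\,M:\mathtt{Trace}\,A$ if $M:\langle\mathsf{cond}:\mathtt{Trace\ Bool};\mathsf{out}:\mathtt{Trace}\,A\rangle$; $\mathtt{For}\,C\,M:\mathtt{Trace}\,A$ if $C:\mathit{Type}$,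 $M:\langle\mathsf{in}:\mathtt{T}(\mathtt{TRACE}\,C);\mathsf{out}:\mathtt{Trace}\,A\rangle$; $\mathtt{Cell}\,M:\mathtt{Trace}\,A$ if $M:\langle\mathsf{tbl}:\mathtt{String};\mathsf{col}:\mathtt{String};\mathsf{row}:\mathtt{Int};\mathsf{val}:A\rangle$; $\mathtt{OpEq}\,C\,M:\mathtt{Trace\ Bool}$ if $C:\mathit{Type}$, $M:\langle\mathsf{l}:\mathtt{T}(\mathtt{TRACE}\,C);\mathsf{r}:\mathtt{T}(\mathtt{TRACE}\,C)\rangle$; $\mathtt{OpPlus}\,M:\mathtt{Trace\ Int}$ if $M:\langle\mathsf{l}:\mathtt{Trace\ Int};\mathsf{r}:\mathtt{Trace\ Int}\rangle$. $\mathbf{tracecase}\ M\ \mathbf{of}\,(x.M_L,x.M_I,\alpha.x.M_F,x.M_C,\alpha.x.M_E,x.M_P):B$ if $M:\mathtt{Trace}\,A$ and each branch has type $B$ in $\Gamma$ extended, respectively, by: $x:A$; $x:\langle\mathsf{cond}:\mathtt{Trace\ Bool};\mathsf{out}:\mathtt{Trace}\,A\rangle$; $\alpha:\mathit{Type},x:\langle\mathsf{in}:\mathtt{T}(\mathtt{TRACE}\,\alpha);\mathsf{out}:\mathtt{Trace}\,A\rangle$; $x:\langle\mathsf{tbl}:\mathtt{String};\mathsf{col}:\mathtt{String};\mathsf{row}:\mathtt{Int};\mathsf{val}:A\rangle$; $\alpha:\mathit{Type},x:\langle\mathsf{l}:\mathtt{T}(\mathtt{TRACE}\,\alpha);\mathsf{r}:\mathtt{T}(\mathtt{TRACE}\,\alpha)\rangle$;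 $x:\langle\mathsf{l}:\mathtt{Trace\ Int};\mathsf{r}:\mathtt{Trace\ Int}\rangle$. **Term reduction** $M\leadsto M'$. $\beta$-rules: $(\lambda x.M)\,N\leadsto M[x:=N]$; $\mathbf{fix}\,f.M\leadsto M[f:=\mathbf{fix}\,f.M]$; $(\Lambda\alpha.M)\,C\leadsto M[\alpha:=C]$; $\mathbf{if}\ \mathbf{true}\ \mathbf{then}\ M\ \mathbf{else}\ N\leadsto M$; $\mathbf{if}\ \mathbf{false}\ \mathbf{then}\ M\ \mathbf{else}\ N\leadsto N$; $\langle\overline{l_i=M_i}\rangle.l_i\leadsto M_i$; $\mathbf{rmap}^{(\overline{l_i:C_i})}M\,N\leadsto\langle\overline{l_i=(M\,C_i)\,N.l_i}\rangle$; $\mathbf{rfold}^{(l_1:C_1;\dots;l_n:C_n)}L\,M\,N\leadsto L\,N.l_1\,(L\,N.l_2\cdots(L\,N.l_n\,M)\cdots)$; $\mathbf{for}\,(x\leftarrow[])\,N\leadsto[]$; $\mathbf{for}\,(x\leftarrow[M])\,N\leadsto N[x:=M]$; $\mathbf{tracecase}$ applied to $\mathtt{Lit}\,M$, $\mathtt{If}\,M$, $\mathtt{For}\,C\,M$, $\mathtt{Cell}\,M$, $\mathtt{OpEq}\,C\,M$, $\mathtt{OpPlus}\,M$ reduces respectively to $M_L[x:=M]$, $M_I[x:=M]$, $M_F[\alpha:=C,x:=M]$, $M_C[x:=M]$, $M_E[\alpha:=C,x:=M]$, $M_P[x:=M]$; $\mathbf{typecase}$ on $\mathtt{Bool}^*,\mathtt{Int}^*,\mathtt{String}^*,\mathtt{List}^*C,\mathtt{Record}^*S,\mathtt{Trace}^*C$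 reduces respectively to $M_B$, $M_I$, $M_S$, $M_L[\beta:=C]$, $M_R[\rho:=S]$, $M_T[\gamma:=C]$. Commuting conversions: $(\mathbf{if}\ L\ \mathbf{then}\ M_1\ \mathbf{else}\ M_2)\,N\leadsto\mathbf{if}\ L\ \mathbf{then}\ M_1\,N\ \mathbf{else}\ M_2\,N$; the same with a constructor argument $C$ for $N$; $(\mathbf{if}\ L\ \mathbf{then}\ M\ \mathbf{else}\ N).l\leadsto\mathbf{if}\ L\ \mathbf{then}\ M.l\ \mathbf{else}\ N.l$; $\mathbf{for}\,(x\leftarrow M_1\mathbin{+\!\!+}M_2)\,N\leadsto(\mathbf{for}\,(x\leftarrow M_1)\,N)\mathbin{+\!\!+}(\mathbf{for}\,(x\leftarrow M_2)\,N)$; $\mathbf{for}\,(x\leftarrow\mathbf{for}\,(y\leftarrow L)\,M)\,N\leadsto\mathbf{for}\,(y\leftarrow L)\,\mathbf{for}\,(x\leftarrow M)\,N$; $\mathbf{if}\,(\mathbf{if}\ L\ \mathbf{then}\ M_1\ \mathbf{else}\ M_2)\ \mathbf{then}\ N_1\ \mathbf{else}\ N_2\leadsto\mathbf{if}\ L\ \mathbf{then}\,(\mathbf{if}\ M_1\ \mathbf{then}\ N_1\ \mathbf{else}\ N_2)\ \mathbf{else}\,(\mathbf{if}\ M_2\ \mathbf{then}\ N_1\ \mathbf{else}\ N_2)$; $\mathbf{for}\,(x\leftarrow\mathbf{if}\ L\ \mathbf{then}\ M_1\ \mathbf{else}\ M_2)\,N\leadsto\mathbf{if}\ L\ \mathbf{then}\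 \mathbf{for}\,(x\leftarrow M_1)\,N\ \mathbf{else}\ \mathbf{for}\,(x\leftarrow M_2)\,N$; $\mathbf{tracecase}\,(\mathbf{if}\ L\ \mathbf{then}\ M_1\ \mathbf{else}\ M_2)\ \mathbf{of}\ \vec M\leadsto\mathbf{if}\ L\ \mathbf{then}\ \mathbf{tracecase}\ M_1\ \mathbf{of}\ \vec M\ \mathbf{else}\ \mathbf{tracecase}\ M_2\ \mathbf{of}\ \vec M$. Congruence: reduction is allowed in any immediate subterm (including under binders and in case branches) of any term former except the body of $\mathbf{fix}$, and, by constructor reduction, in the (row) constructor $C$ or $S$ of $M\,C$, $\mathbf{rmap}^S$, $\mathbf{rfold}^S$, $\mathtt{For}\,C\,M$, $\mathtt{OpEq}\,C\,M$ and $\mathbf{typecase}\ C$. **Normal forms.** Normal constructors $C::=E\mid\mathtt{Bool}^*\mid\mathtt{Int}^*\mid\mathtt{String}^*\mid\lambda\alpha{:}K.C\mid\mathtt{List}^*C\mid\mathtt{Record}^*S\mid\mathtt{Trace}^*C$; neutral constructors $E::=\alpha\mid E\,C\mid\mathbf{Typerec}\,E\,(C_B,C_I,C_S,C_L,C_R,C_T)$ (row arguments being normal rows); normal rows $S::=U\mid\cdot\mid l:C;S$; neutral rows $U::=\rho\mid l:C;U\mid\mathbf{Rmap}\,C\,U$. Normal terms $L,M,N::=F\mid c\mid\lambda x{:}A.M\mid\Lambda\alpha{:}K.M\mid\mathbf{if}\ H\ \mathbf{then}\ M\ \mathbf{else}\ N\mid M+N\mid M==N\mid\langle\rangle\mid\langle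 l=M;N\rangle\mid[]\mid[M]\mid M\mathbin{+\!\!+}N\mid\mathbf{for}\,(x\leftarrow T)\,N\mid\mathbf{table}\ n\ \langle R\rangle\mid\mathtt{Lit}\,M\mid\mathtt{If}\,M\mid\mathtt{For}\,C\,M\mid\mathtt{Cell}\,M\mid\mathtt{OpEq}\,C\,M\mid\mathtt{OpPlus}\,M$. Neutral terms $F::=x\mid P.l\mid F\,M\mid F\,C\mid\mathbf{rfold}^U L\,M\,N\mid\mathbf{rmap}^U M\,N\mid\mathbf{tracecase}\ F\ \mathbf{of}\,(x.M_L,x.M_I,\alpha.x.M_F,x.M_C,\alpha.x.M_E,x.M_P)\mid\mathbf{typecase}\ E\ \mathbf{of}\,(M_B,M_I,M_S,\beta.M_L,\rho.M_R,\gamma.M_T)$ (all branches normal). $H::=F\mid M==N$; $P::=F\mid\mathbf{rmap}^U M\,N$; $T::=F\mid\mathbf{table}\ n\ \langle R\rangle$. ''In normal form'' means generated as a normal term.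
   Formalization: The projection rule selects an explicit field of any iterated record extension, whatever its innermost tail, not only extensions of ⟨⟩; with the literal rule progress fails for ⟨l=1;x⟩.l with x:⟨·⟩, which is well typed, not normal and irreducible. *)

(* Defs.v *)
From Stdlib Require Import List String ZArith.
Import ListNotations.

(** Binding is represented by de Bruijn indices, with two separate index
    spaces: one for type variables (of every kind, including the row
    variables of kind [Row]) and one for term variables.  Accordingly a
    context is a pair [D; G], where [D] lists the kinds of the type variables
    and [G] the types of the term variables, and every type in [G] lives
    over [D]. *)

Definition label := string.

Inductive kind : Set :=
| KType
| KRow
| KArr (K1 K2 : kind).

(** The raw syntax does not separate constructors from row constructors; the
    two grammatical categories are separated by the kinding judgements
    [con_kind] and [row_kind], so that in a well-kinded [CRecord S] the row
    [S] is built from variables, [CNil], [CExt] and [CRmap] only, while the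
    argument of a [CApp] may belong to either category. *)
Inductive con : Set :=
| CVar (a : nat)
| CBool
| CInt
| CString
| CLam (K : kind) (C : con)
| CApp (C D : con)
| CList (C : con)
| CRecord (S : con)
| CTrace (C : con)
| CTyperec (C CB CI CS CL CR CT : con)
| CNil
| CExt (l : label) (C S : con)
| CRmap (C S : con).

Definition scons {X : Type} (x : X) (f : nat -> X) (n : nat) : X :=
  match n with
  | 0 => x
  | S m => f m
  end.

Definition up_ren (xi : nat -> nat) : nat -> nat :=
  scons 0 (fun n => S (xi n)).

Fixpoint con_ren (xi : nat -> nat) (C : con) : con :=
  match C with
  | CVar a => CVar (xi a)
  | CBool => CBool
  | CInt => CInt
  | CString => CString
  | CLam K C => CLam K (con_ren (up_ren xi) C)
  | CApp C D => CApp (con_ren xi C) (con_ren xi D)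
  | CList C => CList (con_ren xi C)
  | CRecord S0 => CRecord (con_ren xi S0)
  | CTrace C => CTrace (con_ren xi C)
  | CTyperec C CB CI CS CL CR CT =>
      CTyperec (con_ren xi C) (con_ren xi CB) (con_ren xi CI) (con_ren xi CS)
        (con_ren xi CL) (con_ren xi CR) (con_ren xi CT)
  | CNil => CNil
  | CExt l C S0 => CExt l (con_ren xi C) (con_ren xi S0)
  | CRmap C S0 => CRmap (con_ren xi C) (con_ren xi S0)
  end.

Definition con_shift : con -> con := con_ren S.

Definition up_con (s : nat -> con) : nat -> con :=
  scons (CVar 0) (fun n => con_shift (s n)).

Fixpoint con_subst (s : nat -> con) (C : con) : con :=
  match C with
  | CVar a => s a
  | CBool => CBool
  | CInt => CInt
  | CString => CString
  | CLam K C => CLam K (con_subst (up_con s) C)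
  | CApp C D => CApp (con_subst s C) (con_subst s D)
  | CList C => CList (con_subst s C)
  | CRecord S0 => CRecord (con_subst s S0)
  | CTrace C => CTrace (con_subst s C)
  | CTyperec C CB CI CS CL CR CT =>
      CTyperec (con_subst s C) (con_subst s CB) (con_subst s CI)
        (con_subst s CS) (con_subst s CL) (con_subst s CR) (con_subst s CT)
  | CNil => CNil
  | CExt l C S0 => CExt l (con_subst s C) (con_subst s S0)
  | CRmap C S0 => CRmap (con_subst s C) (con_subst s S0)
  end.

Definition con_subst1 (D C : con) : con := con_subst (scons D CVar) C.

Inductive con_kind : list kind -> con -> kind -> Prop :=
| con_kind_var D a K :
    nth_error D a = Some K -> con_kind D (CVar a) K
| con_kind_bool D : con_kind D CBool KType
| con_kind_int D : con_kind D CInt KType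
| con_kind_string D : con_kind D CString KType
| con_kind_lam D K1 K2 C :
    con_kind (K1 :: D) C K2 -> con_kind D (CLam K1 C) (KArr K1 K2)
| con_kind_app D C C' K1 K2 :
    con_kind D C (KArr K1 K2) -> con_kind D C' K1 ->
    con_kind D (CApp C C') K2
| con_kind_app_row D C S K :
    con_kind D C (KArr KRow K) -> row_kind D S ->
    con_kind D (CApp C S) K
| con_kind_list D C : con_kind D C KType -> con_kind D (CList C) KType
| con_kind_record D S : row_kind D S -> con_kind D (CRecord S) KType
| con_kind_trace D C : con_kind D C KType -> con_kind D (CTrace C) KType
| con_kind_typerec D C CB CI CS CL CR CT K :
    con_kind D C KType ->
    con_kind D CB K -> con_kind D CI K -> con_kind D CS K ->
    con_kind D CL (KArr KType (KArr K K)) ->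
    con_kind D CR (KArr KRow (KArr KRow K)) ->
    con_kind D CT (KArr KType (KArr K K)) ->
    con_kind D (CTyperec C CB CI CS CL CR CT) K

with row_kind : list kind -> con -> Prop :=
| row_kind_nil D : row_kind D CNil
| row_kind_ext D l C S :
    con_kind D C KType -> row_kind D S -> row_kind D (CExt l C S)
| row_kind_var D a :
    nth_error D a = Some KRow -> row_kind D (CVar a)
| row_kind_rmap D C S :
    con_kind D C (KArr KType KType) -> row_kind D S ->
    row_kind D (CRmap C S).

(** Arguments of polymorphic terms may be constructors or rows. *)
Definition arg_kind (D : list kind) (C : con) (K : kind) : Prop :=
  con_kind D C K \/ (K = KRow /\ row_kind D C).

Inductive con_step : con -> con -> Prop :=
| cs_beta K C D : con_step (CApp (CLam K C) D) (con_subst1 D C)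
| cs_rmap_nil C : con_step (CRmap C CNil) CNil
| cs_rmap_ext C l D S :
    con_step (CRmap C (CExt l D S)) (CExt l (CApp C D) (CRmap C S))
| cs_typerec_bool CB CI CS CL CR CT :
    con_step (CTyperec CBool CB CI CS CL CR CT) CB
| cs_typerec_int CB CI CS CL CR CT :
    con_step (CTyperec CInt CB CI CS CL CR CT) CI
| cs_typerec_string CB CI CS CL CR CT :
    con_step (CTyperec CString CB CI CS CL CR CT) CS
| cs_typerec_list D CB CI CS CL CR CT :
    con_step (CTyperec (CList D) CB CI CS CL CR CT)
      (CApp (CApp CL D) (CTyperec D CB CI CS CL CR CT))
| cs_typerec_record S CB CI CS CL CR CT :
    con_step (CTyperec (CRecord S) CB CI CS CL CR CT)
      (CApp (CApp CR S)
         (CRmap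
            (CLam KType
               (CTyperec (CVar 0) (con_shift CB) (con_shift CI) (con_shift CS)
                  (con_shift CL) (con_shift CR) (con_shift CT)))
            S))
| cs_typerec_trace D CB CI CS CL CR CT :
    con_step (CTyperec (CTrace D) CB CI CS CL CR CT)
      (CApp (CApp CT D) (CTyperec D CB CI CS CL CR CT))
| cs_lam K C C' : con_step C C' -> con_step (CLam K C) (CLam K C')
| cs_app_l C C' D : con_step C C' -> con_step (CApp C D) (CApp C' D)
| cs_app_r C D D' : con_step D D' -> con_step (CApp C D) (CApp C D')
| cs_list C C' : con_step C C' -> con_step (CList C) (CList C')
| cs_record S S' : con_step S S' -> con_step (CRecord S) (CRecord S')
| cs_trace C C' : con_step C C' -> con_step (CTrace C) (CTrace C')
| cs_typerec_C C C' CB CI CS CL CR CT :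
    con_step C C' ->
    con_step (CTyperec C CB CI CS CL CR CT) (CTyperec C' CB CI CS CL CR CT)
| cs_typerec_CB C CB CB' CI CS CL CR CT :
    con_step CB CB' ->
    con_step (CTyperec C CB CI CS CL CR CT) (CTyperec C CB' CI CS CL CR CT)
| cs_typerec_CI C CB CI CI' CS CL CR CT :
    con_step CI CI' ->
    con_step (CTyperec C CB CI CS CL CR CT) (CTyperec C CB CI' CS CL CR CT)
| cs_typerec_CS C CB CI CS CS' CL CR CT :
    con_step CS CS' ->
    con_step (CTyperec C CB CI CS CL CR CT) (CTyperec C CB CI CS' CL CR CT)
| cs_typerec_CL C CB CI CS CL CL' CR CT :
    con_step CL CL' ->
    con_step (CTyperec C CB CI CS CL CR CT) (CTyperec C CB CI CS CL' CR CT)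
| cs_typerec_CR C CB CI CS CL CR CR' CT :
    con_step CR CR' ->
    con_step (CTyperec C CB CI CS CL CR CT) (CTyperec C CB CI CS CL CR' CT)
| cs_typerec_CT C CB CI CS CL CR CT CT' :
    con_step CT CT' ->
    con_step (CTyperec C CB CI CS CL CR CT) (CTyperec C CB CI CS CL CR CT')
| cs_ext_l l C C' S : con_step C C' -> con_step (CExt l C S) (CExt l C' S)
| cs_ext_r l C S S' : con_step S S' -> con_step (CExt l C S) (CExt l C S')
| cs_rmap_l C C' S : con_step C C' -> con_step (CRmap C S) (CRmap C' S)
| cs_rmap_r C S S' : con_step S S' -> con_step (CRmap C S) (CRmap C S').

Inductive con_eq : list kind -> con -> con -> kind -> Prop :=
| con_eq_refl D C K : con_kind D C K -> con_eq D C C K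
| con_eq_sym D C C' K : con_eq D C C' K -> con_eq D C' C K
| con_eq_trans D C1 C2 C3 K :
    con_eq D C1 C2 K -> con_eq D C2 C3 K -> con_eq D C1 C3 K
| con_eq_step D C C' K :
    con_kind D C K -> con_kind D C' K -> con_step C C' -> con_eq D C C' K
| con_eq_eta D C K1 K2 :
    con_kind D C (KArr K1 K2) ->
    con_eq D (CLam K1 (CApp (con_shift C) (CVar 0))) C (KArr K1 K2)
| con_eq_lam D K1 K2 C C' :
    con_eq (K1 :: D) C C' K2 ->
    con_eq D (CLam K1 C) (CLam K1 C') (KArr K1 K2)
| con_eq_app D C1 C1' C2 C2' K1 K2 :
    con_eq D C1 C1' (KArr K1 K2) -> con_eq D C2 C2' K1 ->
    con_eq D (CApp C1 C2) (CApp C1' C2') K2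
| con_eq_app_row D C C' S S' K :
    con_eq D C C' (KArr KRow K) -> row_eq D S S' ->
    con_eq D (CApp C S) (CApp C' S') K
| con_eq_list D C C' :
    con_eq D C C' KType -> con_eq D (CList C) (CList C') KType
| con_eq_record D S S' :
    row_eq D S S' -> con_eq D (CRecord S) (CRecord S') KType
| con_eq_trace D C C' :
    con_eq D C C' KType -> con_eq D (CTrace C) (CTrace C') KType
| con_eq_typerec D C C' CB CB' CI CI' CS CS' CL CL' CR CR' CT CT' K :
    con_eq D C C' KType ->
    con_eq D CB CB' K -> con_eq D CI CI' K -> con_eq D CS CS' K ->
    con_eq D CL CL' (KArr KType (KArr K K)) ->
    con_eq D CR CR' (KArr KRow (KArr KRow K)) ->
    con_eq D CT CT' (KArr KType (KArr K K)) ->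
    con_eq D (CTyperec C CB CI CS CL CR CT)
      (CTyperec C' CB' CI' CS' CL' CR' CT') K

with row_eq : list kind -> con -> con -> Prop :=
| row_eq_refl D S : row_kind D S -> row_eq D S S
| row_eq_sym D S S' : row_eq D S S' -> row_eq D S' S
| row_eq_trans D S1 S2 S3 :
    row_eq D S1 S2 -> row_eq D S2 S3 -> row_eq D S1 S3
| row_eq_step D S S' :
    row_kind D S -> row_kind D S' -> con_step S S' -> row_eq D S S'
| row_eq_ext D l C C' S S' :
    con_eq D C C' KType -> row_eq D S S' ->
    row_eq D (CExt l C S) (CExt l C' S')
| row_eq_rmap D C C' S S' :
    con_eq D C C' (KArr KType KType) -> row_eq D S S' ->
    row_eq D (CRmap C S) (CRmap C' S').

Inductive ty : Set :=
| TT (C : con)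
| TBool
| TInt
| TString
| TArr (A B : ty)
| TList (A : ty)
| TRecord (R : rty)
| TTrace (A : ty)
| TForall (K : kind) (A : ty)

with rty : Set :=
| RNil
| RExt (l : label) (A : ty) (R : rty)
| RT (S : con).

Fixpoint ty_ren (xi : nat -> nat) (A : ty) : ty :=
  match A with
  | TT C => TT (con_ren xi C)
  | TBool => TBool
  | TInt => TInt
  | TString => TString
  | TArr A B => TArr (ty_ren xi A) (ty_ren xi B)
  | TList A => TList (ty_ren xi A)
  | TRecord R => TRecord (rty_ren xi R)
  | TTrace A => TTrace (ty_ren xi A)
  | TForall K A => TForall K (ty_ren (up_ren xi) A)
  end

with rty_ren (xi : nat -> nat) (R : rty) : rty :=
  match R with
  | RNil => RNil
  | RExt l A R => RExt l (ty_ren xi A) (rty_ren xi R)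
  | RT S0 => RT (con_ren xi S0)
  end.

Definition ty_shift : ty -> ty := ty_ren S.

Fixpoint ty_subst (s : nat -> con) (A : ty) : ty :=
  match A with
  | TT C => TT (con_subst s C)
  | TBool => TBool
  | TInt => TInt
  | TString => TString
  | TArr A B => TArr (ty_subst s A) (ty_subst s B)
  | TList A => TList (ty_subst s A)
  | TRecord R => TRecord (rty_subst s R)
  | TTrace A => TTrace (ty_subst s A)
  | TForall K A => TForall K (ty_subst (up_con s) A)
  end

with rty_subst (s : nat -> con) (R : rty) : rty :=
  match R with
  | RNil => RNil
  | RExt l A R => RExt l (ty_subst s A) (rty_subst s R)
  | RT S0 => RT (con_subst s S0)
  end.

Definition ty_subst1 (C : con) (A : ty) : ty := ty_subst (scons C CVar) A.

(** [B[alpha := C]] where [B] has the innermost type variable [alpha] and [C]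
    lives under one fresh type variable that takes its place, as in
    [B[alpha := List beta]]. *)
Definition ty_subst_under (C : con) (B : ty) : ty :=
  ty_subst (scons C (fun n => CVar (S n))) B.

Inductive ty_kind : list kind -> ty -> Prop :=
| ty_kind_T D C : con_kind D C KType -> ty_kind D (TT C)
| ty_kind_bool D : ty_kind D TBool
| ty_kind_int D : ty_kind D TInt
| ty_kind_string D : ty_kind D TString
| ty_kind_arr D A B : ty_kind D A -> ty_kind D B -> ty_kind D (TArr A B)
| ty_kind_list D A : ty_kind D A -> ty_kind D (TList A)
| ty_kind_record D R : rty_kind D R -> ty_kind D (TRecord R)
| ty_kind_trace D A : ty_kind D A -> ty_kind D (TTrace A)
| ty_kind_forall D K A : ty_kind (K :: D) A -> ty_kind D (TForall K A)

with rty_kind : list kind -> rty -> Prop :=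
| rty_kind_nil D : rty_kind D RNil
| rty_kind_ext D l A R :
    ty_kind D A -> rty_kind D R -> rty_kind D (RExt l A R)
| rty_kind_T D S : row_kind D S -> rty_kind D (RT S).

Inductive ty_eq : list kind -> ty -> ty -> Prop :=
| ty_eq_refl D A : ty_kind D A -> ty_eq D A A
| ty_eq_sym D A B : ty_eq D A B -> ty_eq D B A
| ty_eq_trans D A1 A2 A3 : ty_eq D A1 A2 -> ty_eq D A2 A3 -> ty_eq D A1 A3
| ty_eq_con D C C' : con_eq D C C' KType -> ty_eq D (TT C) (TT C')
| ty_eq_T_bool D : ty_eq D (TT CBool) TBool
| ty_eq_T_int D : ty_eq D (TT CInt) TInt
| ty_eq_T_string D : ty_eq D (TT CString) TString
| ty_eq_T_list D C :
    con_kind D C KType -> ty_eq D (TT (CList C)) (TList (TT C))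
| ty_eq_T_record D S :
    row_kind D S -> ty_eq D (TT (CRecord S)) (TRecord (RT S))
| ty_eq_T_trace D C :
    con_kind D C KType -> ty_eq D (TT (CTrace C)) (TTrace (TT C))
| ty_eq_arr D A A' B B' :
    ty_eq D A A' -> ty_eq D B B' -> ty_eq D (TArr A B) (TArr A' B')
| ty_eq_list D A A' : ty_eq D A A' -> ty_eq D (TList A) (TList A')
| ty_eq_record D R R' : rty_eq D R R' -> ty_eq D (TRecord R) (TRecord R')
| ty_eq_trace D A A' : ty_eq D A A' -> ty_eq D (TTrace A) (TTrace A')
| ty_eq_forall D K A A' :
    ty_eq (K :: D) A A' -> ty_eq D (TForall K A) (TForall K A')

with rty_eq : list kind -> rty -> rty -> Prop :=
| rty_eq_refl D R : rty_kind D R -> rty_eq D R R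
| rty_eq_sym D R R' : rty_eq D R R' -> rty_eq D R' R
| rty_eq_trans D R1 R2 R3 :
    rty_eq D R1 R2 -> rty_eq D R2 R3 -> rty_eq D R1 R3
| rty_eq_row D S S' : row_eq D S S' -> rty_eq D (RT S) (RT S')
| rty_eq_T_nil D : rty_eq D (RT CNil) RNil
| rty_eq_T_ext D l C S :
    con_kind D C KType -> row_kind D S ->
    rty_eq D (RT (CExt l C S)) (RExt l (TT C) (RT S))
| rty_eq_ext D l A A' R R' :
    ty_eq D A A' -> rty_eq D R R' -> rty_eq D (RExt l A R) (RExt l A' R').

Inductive const : Set :=
| KBool (b : bool)
| KInt (z : Z)
| KString (s : string).

Definition const_ty (c : const) : ty :=
  match c with
  | KBool _ => TBool
  | KInt _ => TInt
  | KString _ => TString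
  end.

(** Binders: [MLam], [MFix] and the second argument of [MFor] bind a term
    variable, [MTLam] a type variable.  In [MTypecase] the last three branches
    bind a type variable each.  In [MTracecase] every branch binds a term
    variable, and the branches [MF] and [ME] also bind a type variable. *)
Inductive tm : Set :=
| MVar (x : nat)
| MConst (c : const)
| MLam (A : ty) (M : tm)
| MApp (M N : tm)
| MTLam (K : kind) (M : tm)
| MCApp (M : tm) (C : con)
| MFix (A : ty) (M : tm)
| MIf (L M N : tm)
| MPlus (M N : tm)
| MEq (M N : tm)
| MUnit
| MExt (l : label) (M N : tm)
| MProj (M : tm) (l : label)
| MNil
| MSing (M : tm)
| MAppend (M N : tm)
| MFor (M N : tm)
| MTable (n : string) (R : rty)
| MRmap (S : con) (M N : tm)
| MRfold (S : con) (L M N : tm)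
| MTypecase (C : con) (MB MI MS ML MR MT : tm)
| MLit (M : tm)
| MTrIf (M : tm)
| MTrFor (C : con) (M : tm)
| MCell (M : tm)
| MOpEq (C : con) (M : tm)
| MOpPlus (M : tm)
| MTracecase (M ML MI MF MC ME MP : tm).

(** [xi] renames type variables, [zeta] term variables. *)
Fixpoint tm_ren (xi zeta : nat -> nat) (M : tm) : tm :=
  match M with
  | MVar x => MVar (zeta x)
  | MConst c => MConst c
  | MLam A M => MLam (ty_ren xi A) (tm_ren xi (up_ren zeta) M)
  | MApp M N => MApp (tm_ren xi zeta M) (tm_ren xi zeta N)
  | MTLam K M => MTLam K (tm_ren (up_ren xi) zeta M)
  | MCApp M C => MCApp (tm_ren xi zeta M) (con_ren xi C)
  | MFix A M => MFix (ty_ren xi A) (tm_ren xi (up_ren zeta) M)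
  | MIf L M N => MIf (tm_ren xi zeta L) (tm_ren xi zeta M) (tm_ren xi zeta N)
  | MPlus M N => MPlus (tm_ren xi zeta M) (tm_ren xi zeta N)
  | MEq M N => MEq (tm_ren xi zeta M) (tm_ren xi zeta N)
  | MUnit => MUnit
  | MExt l M N => MExt l (tm_ren xi zeta M) (tm_ren xi zeta N)
  | MProj M l => MProj (tm_ren xi zeta M) l
  | MNil => MNil
  | MSing M => MSing (tm_ren xi zeta M)
  | MAppend M N => MAppend (tm_ren xi zeta M) (tm_ren xi zeta N)
  | MFor M N => MFor (tm_ren xi zeta M) (tm_ren xi (up_ren zeta) N)
  | MTable n R => MTable n (rty_ren xi R)
  | MRmap S0 M N => MRmap (con_ren xi S0) (tm_ren xi zeta M) (tm_ren xi zeta N)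
  | MRfold S0 L M N =>
      MRfold (con_ren xi S0) (tm_ren xi zeta L) (tm_ren xi zeta M)
        (tm_ren xi zeta N)
  | MTypecase C MB MI MS ML MR MT =>
      MTypecase (con_ren xi C)
        (tm_ren xi zeta MB) (tm_ren xi zeta MI) (tm_ren xi zeta MS)
        (tm_ren (up_ren xi) zeta ML) (tm_ren (up_ren xi) zeta MR)
        (tm_ren (up_ren xi) zeta MT)
  | MLit M => MLit (tm_ren xi zeta M)
  | MTrIf M => MTrIf (tm_ren xi zeta M)
  | MTrFor C M => MTrFor (con_ren xi C) (tm_ren xi zeta M)
  | MCell M => MCell (tm_ren xi zeta M)
  | MOpEq C M => MOpEq (con_ren xi C) (tm_ren xi zeta M)
  | MOpPlus M => MOpPlus (tm_ren xi zeta M)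
  | MTracecase M ML MI MF MC ME MP =>
      MTracecase (tm_ren xi zeta M)
        (tm_ren xi (up_ren zeta) ML) (tm_ren xi (up_ren zeta) MI)
        (tm_ren (up_ren xi) (up_ren zeta) MF) (tm_ren xi (up_ren zeta) MC)
        (tm_ren (up_ren xi) (up_ren zeta) ME) (tm_ren xi (up_ren zeta) MP)
  end.

Definition up_tm (t : nat -> tm) : nat -> tm :=
  scons (MVar 0) (fun n => tm_ren (fun a => a) S (t n)).

Definition tm_cshift (t : nat -> tm) : nat -> tm :=
  fun n => tm_ren S (fun x => x) (t n).

(** Simultaneous substitution of [s] for the type variables and [t] for the
    term variables. *)
Fixpoint tm_subst (s : nat -> con) (t : nat -> tm) (M : tm) : tm :=
  match M with
  | MVar x => t x
  | MConst c => MConst c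
  | MLam A M => MLam (ty_subst s A) (tm_subst s (up_tm t) M)
  | MApp M N => MApp (tm_subst s t M) (tm_subst s t N)
  | MTLam K M => MTLam K (tm_subst (up_con s) (tm_cshift t) M)
  | MCApp M C => MCApp (tm_subst s t M) (con_subst s C)
  | MFix A M => MFix (ty_subst s A) (tm_subst s (up_tm t) M)
  | MIf L M N => MIf (tm_subst s t L) (tm_subst s t M) (tm_subst s t N)
  | MPlus M N => MPlus (tm_subst s t M) (tm_subst s t N)
  | MEq M N => MEq (tm_subst s t M) (tm_subst s t N)
  | MUnit => MUnit
  | MExt l M N => MExt l (tm_subst s t M) (tm_subst s t N)
  | MProj M l => MProj (tm_subst s t M) l
  | MNil => MNil
  | MSing M => MSing (tm_subst s t M)
  | MAppend M N => MAppend (tm_subst s t M) (tm_subst s t N)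
  | MFor M N => MFor (tm_subst s t M) (tm_subst s (up_tm t) N)
  | MTable n R => MTable n (rty_subst s R)
  | MRmap S0 M N => MRmap (con_subst s S0) (tm_subst s t M) (tm_subst s t N)
  | MRfold S0 L M N =>
      MRfold (con_subst s S0) (tm_subst s t L) (tm_subst s t M)
        (tm_subst s t N)
  | MTypecase C MB MI MS ML MR MT =>
      MTypecase (con_subst s C)
        (tm_subst s t MB) (tm_subst s t MI) (tm_subst s t MS)
        (tm_subst (up_con s) (tm_cshift t) ML)
        (tm_subst (up_con s) (tm_cshift t) MR)
        (tm_subst (up_con s) (tm_cshift t) MT)
  | MLit M => MLit (tm_subst s t M)
  | MTrIf M => MTrIf (tm_subst s t M)
  | MTrFor C M => MTrFor (con_subst s C) (tm_subst s t M)
  | MCell M => MCell (tm_subst s t M)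
  | MOpEq C M => MOpEq (con_subst s C) (tm_subst s t M)
  | MOpPlus M => MOpPlus (tm_subst s t M)
  | MTracecase M ML MI MF MC ME MP =>
      MTracecase (tm_subst s t M)
        (tm_subst s (up_tm t) ML) (tm_subst s (up_tm t) MI)
        (tm_subst (up_con s) (up_tm (tm_cshift t)) MF)
        (tm_subst s (up_tm t) MC)
        (tm_subst (up_con s) (up_tm (tm_cshift t)) ME)
        (tm_subst s (up_tm t) MP)
  end.

Definition tm_subst_tm (N M : tm) : tm := tm_subst CVar (scons N MVar) M.
Definition tm_subst_con (C : con) (M : tm) : tm :=
  tm_subst (scons C CVar) MVar M.
Definition tm_subst_both (C : con) (N M : tm) : tm :=
  tm_subst (scons C CVar) (scons N MVar) M.

Definition TRACE : con :=
  CLam KType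
    (CTyperec (CVar 0)
       (CTrace CBool) (CTrace CInt) (CTrace CString)
       (CLam KType (CLam KType (CList (CVar 0))))
       (CLam KRow (CLam KRow (CRecord (CVar 0))))
       (CLam KType (CLam KType (CVar 0)))).

Local Open Scope string_scope.

Inductive base_ty : ty -> Prop :=
| base_bool : base_ty TBool
| base_int : base_ty TInt
| base_string : base_ty TString.

Inductive base_row : rty -> Prop :=
| base_row_nil : base_row RNil
| base_row_ext l A R : base_ty A -> base_row R -> base_row (RExt l A R).

Definition if_row (A : ty) : rty :=
  RExt "cond" (TTrace TBool) (RExt "out" (TTrace A) RNil).
Definition for_row (C : con) (A : ty) : rty :=
  RExt "in" (TT (CApp TRACE C)) (RExt "out" (TTrace A) RNil).
Definition cell_row (A : ty) : rty :=
  RExt "tbl" TString (RExt "col" TString (RExt "row" TInt (RExt "val" A RNil))).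
Definition opeq_row (C : con) : rty :=
  RExt "l" (TT (CApp TRACE C)) (RExt "r" (TT (CApp TRACE C)) RNil).
Definition opplus_row : rty :=
  RExt "l" (TTrace TInt) (RExt "r" (TTrace TInt) RNil).

Definition ctx_shift (G : list ty) : list ty := map ty_shift G.

Inductive has_type : list kind -> list ty -> tm -> ty -> Prop :=
| ht_var D G x A :
    nth_error G x = Some A -> has_type D G (MVar x) A
| ht_const D G c : has_type D G (MConst c) (const_ty c)
| ht_lam D G A B M :
    ty_kind D A -> has_type D (A :: G) M B ->
    has_type D G (MLam A M) (TArr A B)
| ht_app D G A B M N :
    has_type D G M (TArr A B) -> has_type D G N A ->
    has_type D G (MApp M N) B
| ht_tlam D G K A M :
    has_type (K :: D) (ctx_shift G) M A ->
    has_type D G (MTLam K M) (TForall K A)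
| ht_capp D G K A M C :
    has_type D G M (TForall K A) -> arg_kind D C K ->
    has_type D G (MCApp M C) (ty_subst1 C A)
| ht_fix D G A M :
    ty_kind D A -> has_type D (A :: G) M A -> has_type D G (MFix A M) A
| ht_if D G A L M N :
    has_type D G L TBool -> has_type D G M A -> has_type D G N A ->
    has_type D G (MIf L M N) A
| ht_plus D G M N :
    has_type D G M TInt -> has_type D G N TInt ->
    has_type D G (MPlus M N) TInt
| ht_eq D G A M N :
    ty_kind D A -> has_type D G M A -> has_type D G N A ->
    has_type D G (MEq M N) TBool
| ht_unit D G : has_type D G MUnit (TRecord RNil)
| ht_ext D G l A R M N :
    has_type D G M A -> has_type D G N (TRecord R) ->
    has_type D G (MExt l M N) (TRecord (RExt l A R))
| ht_proj D G l A R M :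
    has_type D G M (TRecord (RExt l A R)) -> has_type D G (MProj M l) A
| ht_nil D G A : ty_kind D A -> has_type D G MNil (TList A)
| ht_sing D G A M : has_type D G M A -> has_type D G (MSing M) (TList A)
| ht_append D G A M N :
    has_type D G M (TList A) -> has_type D G N (TList A) ->
    has_type D G (MAppend M N) (TList A)
| ht_for D G A B M N :
    has_type D G M (TList A) -> has_type D (A :: G) N (TList B) ->
    has_type D G (MFor M N) (TList B)
| ht_table D G n R :
    base_row R ->
    has_type D G (MTable n (RExt "oid" TInt R))
      (TList (TRecord (RExt "oid" TInt R)))
| ht_conv D G A B M :
    has_type D G M B -> ty_eq D A B -> has_type D G M A
| ht_rmap D G S C M N :
    row_kind D S -> con_kind D C (KArr KType KType) ->
    has_type D G M
      (TForall KType
         (TArr (TT (CVar 0)) (TT (CApp (con_shift C) (CVar 0))))) ->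
    has_type D G N (TT (CRecord S)) ->
    has_type D G (MRmap S M N) (TT (CRecord (CRmap C S)))
| ht_rfold D G S C L M N :
    row_kind D S -> con_kind D C KType ->
    has_type D G L (TArr (TT C) (TArr (TT C) (TT C))) ->
    has_type D G M (TT C) ->
    has_type D G N (TT (CRecord (CRmap (CLam KType (con_shift C)) S))) ->
    has_type D G (MRfold S L M N) (TT C)
| ht_typecase D G B C MB MI MS ML MR MT :
    con_kind D C KType ->
    ty_kind (KType :: D) B ->
    has_type D G MB (ty_subst1 CBool B) ->
    has_type D G MI (ty_subst1 CInt B) ->
    has_type D G MS (ty_subst1 CString B) ->
    has_type (KType :: D) (ctx_shift G) ML (ty_subst_under (CList (CVar 0)) B) ->
    has_type (KRow :: D) (ctx_shift G) MR (ty_subst_under (CRecord (CVar 0)) B) ->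
    has_type (KType :: D) (ctx_shift G) MT (ty_subst_under (CTrace (CVar 0)) B) ->
    has_type D G (MTypecase C MB MI MS ML MR MT) (ty_subst1 C B)
| ht_lit D G c : has_type D G (MLit (MConst c)) (TTrace (const_ty c))
| ht_trif D G A M :
    has_type D G M (TRecord (if_row A)) -> has_type D G (MTrIf M) (TTrace A)
| ht_trfor D G A C M :
    con_kind D C KType -> has_type D G M (TRecord (for_row C A)) ->
    has_type D G (MTrFor C M) (TTrace A)
| ht_cell D G A M :
    has_type D G M (TRecord (cell_row A)) -> has_type D G (MCell M) (TTrace A)
| ht_opeq D G C M :
    con_kind D C KType -> has_type D G M (TRecord (opeq_row C)) ->
    has_type D G (MOpEq C M) (TTrace TBool)
| ht_opplus D G M :
    has_type D G M (TRecord opplus_row) ->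
    has_type D G (MOpPlus M) (TTrace TInt)
| ht_tracecase D G A B M ML MI MF MC ME MP :
    has_type D G M (TTrace A) ->
    has_type D (A :: G) ML B ->
    has_type D (TRecord (if_row A) :: G) MI B ->
    has_type (KType :: D)
      (TRecord (for_row (CVar 0) (ty_shift A)) :: ctx_shift G) MF (ty_shift B) ->
    has_type D (TRecord (cell_row A) :: G) MC B ->
    has_type (KType :: D)
      (TRecord (opeq_row (CVar 0)) :: ctx_shift G) ME (ty_shift B) ->
    has_type D (TRecord opplus_row :: G) MP B ->
    has_type D G (MTracecase M ML MI MF MC ME MP) B.

Definition wf_ctx (D : list kind) (G : list ty) : Prop := Forall (ty_kind D) G.

(** [M] is an explicit field labelled [l] of the record extension.  The
    innermost record is arbitrary, not necessarily [MUnit]: for a variable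
    [x] of type [TRecord RNil], the term [MProj (MExt l M x) l] is
    well typed and has to be a redex. *)
Inductive has_field : tm -> label -> tm -> Prop :=
| has_field_here l M N : has_field (MExt l M N) l M
| has_field_there l M l' M' N :
    has_field N l M -> has_field (MExt l' M' N) l M.

Definition closed_row (fs : list (label * con)) : con :=
  fold_right (fun f S => CExt (fst f) (snd f) S) CNil fs.

Definition rmap_record (M N : tm) (fs : list (label * con)) : tm :=
  fold_right
    (fun f P => MExt (fst f) (MApp (MCApp M (snd f)) (MProj N (fst f))) P)
    MUnit fs.

Definition rfold_term (L M N : tm) (fs : list (label * con)) : tm :=
  fold_right (fun f P => MApp (MApp L (MProj N (fst f))) P) M fs.

Inductive step : tm -> tm -> Prop :=
| st_beta A M N : step (MApp (MLam A M) N) (tm_subst_tm N M)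
| st_fix A M : step (MFix A M) (tm_subst_tm (MFix A M) M)
| st_tbeta K M C : step (MCApp (MTLam K M) C) (tm_subst_con C M)
| st_if_true M N : step (MIf (MConst (KBool true)) M N) M
| st_if_false M N : step (MIf (MConst (KBool false)) M N) N
| st_proj P l M : has_field P l M -> step (MProj P l) M
| st_rmap fs M N : step (MRmap (closed_row fs) M N) (rmap_record M N fs)
| st_rfold fs L M N : step (MRfold (closed_row fs) L M N) (rfold_term L M N fs)
| st_for_nil N : step (MFor MNil N) MNil
| st_for_sing M N : step (MFor (MSing M) N) (tm_subst_tm M N)
| st_tracecase_lit M ML MI MF MC ME MP :
    step (MTracecase (MLit M) ML MI MF MC ME MP) (tm_subst_tm M ML)
| st_tracecase_if M ML MI MF MC ME MP :
    step (MTracecase (MTrIf M) ML MI MF MC ME MP) (tm_subst_tm M MI)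
| st_tracecase_for C M ML MI MF MC ME MP :
    step (MTracecase (MTrFor C M) ML MI MF MC ME MP) (tm_subst_both C M MF)
| st_tracecase_cell M ML MI MF MC ME MP :
    step (MTracecase (MCell M) ML MI MF MC ME MP) (tm_subst_tm M MC)
| st_tracecase_opeq C M ML MI MF MC ME MP :
    step (MTracecase (MOpEq C M) ML MI MF MC ME MP) (tm_subst_both C M ME)
| st_tracecase_opplus M ML MI MF MC ME MP :
    step (MTracecase (MOpPlus M) ML MI MF MC ME MP) (tm_subst_tm M MP)
| st_typecase_bool MB MI MS ML MR MT :
    step (MTypecase CBool MB MI MS ML MR MT) MB
| st_typecase_int MB MI MS ML MR MT :
    step (MTypecase CInt MB MI MS ML MR MT) MI
| st_typecase_string MB MI MS ML MR MT :
    step (MTypecase CString MB MI MS ML MR MT) MS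
| st_typecase_list C MB MI MS ML MR MT :
    step (MTypecase (CList C) MB MI MS ML MR MT) (tm_subst_con C ML)
| st_typecase_record S MB MI MS ML MR MT :
    step (MTypecase (CRecord S) MB MI MS ML MR MT) (tm_subst_con S MR)
| st_typecase_trace C MB MI MS ML MR MT :
    step (MTypecase (CTrace C) MB MI MS ML MR MT) (tm_subst_con C MT)
| st_app_if L M1 M2 N :
    step (MApp (MIf L M1 M2) N) (MIf L (MApp M1 N) (MApp M2 N))
| st_capp_if L M1 M2 C :
    step (MCApp (MIf L M1 M2) C) (MIf L (MCApp M1 C) (MCApp M2 C))
| st_proj_if L M1 M2 l :
    step (MProj (MIf L M1 M2) l) (MIf L (MProj M1 l) (MProj M2 l))
| st_for_append M1 M2 N :
    step (MFor (MAppend M1 M2) N) (MAppend (MFor M1 N) (MFor M2 N))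
(* [N], under its own variable, moves below the variable bound by the outer
   comprehension of the result *)
| st_for_for L M N :
    step (MFor (MFor L M) N)
      (MFor L (MFor M (tm_ren (fun a => a) (up_ren S) N)))
| st_if_if L M1 M2 N1 N2 :
    step (MIf (MIf L M1 M2) N1 N2) (MIf L (MIf M1 N1 N2) (MIf M2 N1 N2))
| st_for_if L M1 M2 N :
    step (MFor (MIf L M1 M2) N) (MIf L (MFor M1 N) (MFor M2 N))
| st_tracecase_cond L M1 M2 ML MI MF MC ME MP :
    step (MTracecase (MIf L M1 M2) ML MI MF MC ME MP)
      (MIf L (MTracecase M1 ML MI MF MC ME MP)
         (MTracecase M2 ML MI MF MC ME MP))
(* there is no congruence rule for the body of [MFix] *)
| st_c_lam A M M' : step M M' -> step (MLam A M) (MLam A M')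
| st_c_app_l M M' N : step M M' -> step (MApp M N) (MApp M' N)
| st_c_app_r M N N' : step N N' -> step (MApp M N) (MApp M N')
| st_c_tlam K M M' : step M M' -> step (MTLam K M) (MTLam K M')
| st_c_capp_l M M' C : step M M' -> step (MCApp M C) (MCApp M' C)
| st_c_capp_r M C C' : con_step C C' -> step (MCApp M C) (MCApp M C')
| st_c_if_1 L L' M N : step L L' -> step (MIf L M N) (MIf L' M N)
| st_c_if_2 L M M' N : step M M' -> step (MIf L M N) (MIf L M' N)
| st_c_if_3 L M N N' : step N N' -> step (MIf L M N) (MIf L M N')
| st_c_plus_l M M' N : step M M' -> step (MPlus M N) (MPlus M' N)
| st_c_plus_r M N N' : step N N' -> step (MPlus M N) (MPlus M N')
| st_c_eq_l M M' N : step M M' -> step (MEq M N) (MEq M' N)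
| st_c_eq_r M N N' : step N N' -> step (MEq M N) (MEq M N')
| st_c_ext_l l M M' N : step M M' -> step (MExt l M N) (MExt l M' N)
| st_c_ext_r l M N N' : step N N' -> step (MExt l M N) (MExt l M N')
| st_c_proj M M' l : step M M' -> step (MProj M l) (MProj M' l)
| st_c_sing M M' : step M M' -> step (MSing M) (MSing M')
| st_c_append_l M M' N : step M M' -> step (MAppend M N) (MAppend M' N)
| st_c_append_r M N N' : step N N' -> step (MAppend M N) (MAppend M N')
| st_c_for_l M M' N : step M M' -> step (MFor M N) (MFor M' N)
| st_c_for_r M N N' : step N N' -> step (MFor M N) (MFor M N')
| st_c_rmap_S S S' M N : con_step S S' -> step (MRmap S M N) (MRmap S' M N)
| st_c_rmap_l S M M' N : step M M' -> step (MRmap S M N) (MRmap S M' N)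
| st_c_rmap_r S M N N' : step N N' -> step (MRmap S M N) (MRmap S M N')
| st_c_rfold_S S S' L M N :
    con_step S S' -> step (MRfold S L M N) (MRfold S' L M N)
| st_c_rfold_1 S L L' M N :
    step L L' -> step (MRfold S L M N) (MRfold S L' M N)
| st_c_rfold_2 S L M M' N :
    step M M' -> step (MRfold S L M N) (MRfold S L M' N)
| st_c_rfold_3 S L M N N' :
    step N N' -> step (MRfold S L M N) (MRfold S L M N')
| st_c_typecase_C C C' MB MI MS ML MR MT :
    con_step C C' ->
    step (MTypecase C MB MI MS ML MR MT) (MTypecase C' MB MI MS ML MR MT)
| st_c_typecase_B C MB MB' MI MS ML MR MT :
    step MB MB' ->
    step (MTypecase C MB MI MS ML MR MT) (MTypecase C MB' MI MS ML MR MT)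
| st_c_typecase_I C MB MI MI' MS ML MR MT :
    step MI MI' ->
    step (MTypecase C MB MI MS ML MR MT) (MTypecase C MB MI' MS ML MR MT)
| st_c_typecase_S C MB MI MS MS' ML MR MT :
    step MS MS' ->
    step (MTypecase C MB MI MS ML MR MT) (MTypecase C MB MI MS' ML MR MT)
| st_c_typecase_L C MB MI MS ML ML' MR MT :
    step ML ML' ->
    step (MTypecase C MB MI MS ML MR MT) (MTypecase C MB MI MS ML' MR MT)
| st_c_typecase_R C MB MI MS ML MR MR' MT :
    step MR MR' ->
    step (MTypecase C MB MI MS ML MR MT) (MTypecase C MB MI MS ML MR' MT)
| st_c_typecase_T C MB MI MS ML MR MT MT' :
    step MT MT' ->
    step (MTypecase C MB MI MS ML MR MT) (MTypecase C MB MI MS ML MR MT')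
| st_c_lit M M' : step M M' -> step (MLit M) (MLit M')
| st_c_trif M M' : step M M' -> step (MTrIf M) (MTrIf M')
| st_c_trfor_C C C' M : con_step C C' -> step (MTrFor C M) (MTrFor C' M)
| st_c_trfor_M C M M' : step M M' -> step (MTrFor C M) (MTrFor C M')
| st_c_cell M M' : step M M' -> step (MCell M) (MCell M')
| st_c_opeq_C C C' M : con_step C C' -> step (MOpEq C M) (MOpEq C' M)
| st_c_opeq_M C M M' : step M M' -> step (MOpEq C M) (MOpEq C M')
| st_c_opplus M M' : step M M' -> step (MOpPlus M) (MOpPlus M')
| st_c_tracecase_M M M' ML MI MF MC ME MP :
    step M M' ->
    step (MTracecase M ML MI MF MC ME MP) (MTracecase M' ML MI MF MC ME MP)
| st_c_tracecase_L M ML ML' MI MF MC ME MP :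
    step ML ML' ->
    step (MTracecase M ML MI MF MC ME MP) (MTracecase M ML' MI MF MC ME MP)
| st_c_tracecase_I M ML MI MI' MF MC ME MP :
    step MI MI' ->
    step (MTracecase M ML MI MF MC ME MP) (MTracecase M ML MI' MF MC ME MP)
| st_c_tracecase_F M ML MI MF MF' MC ME MP :
    step MF MF' ->
    step (MTracecase M ML MI MF MC ME MP) (MTracecase M ML MI MF' MC ME MP)
| st_c_tracecase_C M ML MI MF MC MC' ME MP :
    step MC MC' ->
    step (MTracecase M ML MI MF MC ME MP) (MTracecase M ML MI MF MC' ME MP)
| st_c_tracecase_E M ML MI MF MC ME ME' MP :
    step ME ME' ->
    step (MTracecase M ML MI MF MC ME MP) (MTracecase M ML MI MF MC ME' MP)
| st_c_tracecase_P M ML MI MF MC ME MP MP' :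
    step MP MP' ->
    step (MTracecase M ML MI MF MC ME MP) (MTracecase M ML MI MF MC ME MP').

(** The nonterminals [C], [E], [S] and [U] of the grammar of normal
    (row) constructors. *)
Inductive con_nf : con -> Prop :=
| con_nf_ne E : con_ne E -> con_nf E
| con_nf_bool : con_nf CBool
| con_nf_int : con_nf CInt
| con_nf_string : con_nf CString
| con_nf_lam K C : con_nf C -> con_nf (CLam K C)
| con_nf_list C : con_nf C -> con_nf (CList C)
| con_nf_record S : row_nf S -> con_nf (CRecord S)
| con_nf_trace C : con_nf C -> con_nf (CTrace C)

with con_ne : con -> Prop :=
| con_ne_var a : con_ne (CVar a)
| con_ne_app E C : con_ne E -> con_nf C -> con_ne (CApp E C)
| con_ne_app_row E S : con_ne E -> row_nf S -> con_ne (CApp E S)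
| con_ne_typerec E CB CI CS CL CR CT :
    con_ne E ->
    con_nf CB -> con_nf CI -> con_nf CS ->
    con_nf CL -> con_nf CR -> con_nf CT ->
    con_ne (CTyperec E CB CI CS CL CR CT)

with row_nf : con -> Prop :=
| row_nf_ne U : row_ne U -> row_nf U
| row_nf_nil : row_nf CNil
| row_nf_ext l C S : con_nf C -> row_nf S -> row_nf (CExt l C S)

with row_ne : con -> Prop :=
| row_ne_var a : row_ne (CVar a)
| row_ne_ext l C U : con_nf C -> row_ne U -> row_ne (CExt l C U)
| row_ne_rmap C U : con_nf C -> row_ne U -> row_ne (CRmap C U).

(** [normal], [neutral], [nf_cond], [nf_proj] and [nf_source] are the
    nonterminals [M], [F], [H], [P] and [T]. *)
Inductive normal : tm -> Prop :=
| nf_neutral F : neutral F -> normal F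
| nf_const c : normal (MConst c)
| nf_lam A M : normal M -> normal (MLam A M)
| nf_tlam K M : normal M -> normal (MTLam K M)
| nf_if H M N : nf_cond H -> normal M -> normal N -> normal (MIf H M N)
| nf_plus M N : normal M -> normal N -> normal (MPlus M N)
| nf_eq M N : normal M -> normal N -> normal (MEq M N)
| nf_unit : normal MUnit
| nf_ext l M N : normal M -> normal N -> normal (MExt l M N)
| nf_nil : normal MNil
| nf_sing M : normal M -> normal (MSing M)
| nf_append M N : normal M -> normal N -> normal (MAppend M N)
| nf_for T N : nf_source T -> normal N -> normal (MFor T N)
| nf_table n R : normal (MTable n R)
| nf_lit M : normal M -> normal (MLit M)
| nf_trif M : normal M -> normal (MTrIf M)
| nf_trfor C M : con_nf C -> normal M -> normal (MTrFor C M)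
| nf_cell M : normal M -> normal (MCell M)
| nf_opeq C M : con_nf C -> normal M -> normal (MOpEq C M)
| nf_opplus M : normal M -> normal (MOpPlus M)

with neutral : tm -> Prop :=
| ne_var x : neutral (MVar x)
| ne_proj P l : nf_proj P -> neutral (MProj P l)
| ne_app F M : neutral F -> normal M -> neutral (MApp F M)
| ne_capp F C : neutral F -> con_nf C -> neutral (MCApp F C)
| ne_capp_row F S : neutral F -> row_nf S -> neutral (MCApp F S)
| ne_rfold U L M N :
    row_ne U -> normal L -> normal M -> normal N -> neutral (MRfold U L M N)
| ne_rmap U M N :
    row_ne U -> normal M -> normal N -> neutral (MRmap U M N)
| ne_tracecase F ML MI MF MC ME MP :
    neutral F ->
    normal ML -> normal MI -> normal MF ->
    normal MC -> normal ME -> normal MP ->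
    neutral (MTracecase F ML MI MF MC ME MP)
| ne_typecase E MB MI MS ML MR MT :
    con_ne E ->
    normal MB -> normal MI -> normal MS ->
    normal ML -> normal MR -> normal MT ->
    neutral (MTypecase E MB MI MS ML MR MT)

with nf_cond : tm -> Prop :=
| nf_cond_ne F : neutral F -> nf_cond F
| nf_cond_eq M N : normal M -> normal N -> nf_cond (MEq M N)

with nf_proj : tm -> Prop :=
| nf_proj_ne F : neutral F -> nf_proj F
| nf_proj_rmap U M N :
    row_ne U -> normal M -> normal N -> nf_proj (MRmap U M N)

with nf_source : tm -> Prop :=
| nf_source_ne F : neutral F -> nf_source F
| nf_source_table n R : nf_source (MTable n R).

(* Main.v *)
Require Import Defs.
From Stdlib Require Import List.
From Stdlib Require Import Eqdep_dec FunctionalExtensionality.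

(** Type equivalence contains [beta], [eta] and [Typerec], so the canonical
    forms needed for progress are obtained semantically rather than from
    confluence.  Constructors are interpreted in the full set-theoretic model
    over [KType := sty], [KRow := srow]; equivalent types have equal
    interpretations, and the interpretation of a type exhibits its outermost
    type former (and, for records, the first label). *)

(** * Semantic kinds, values and coercions *)

(** Function and polymorphic types are recorded without their components:
    only the head is ever used. *)
Inductive sty : Set :=
| SBool
| SInt
| SString
| SList (a : sty)
| SRecord (r : srow)
| STrace (a : sty)
| SArr
| SForall
with srow : Set :=
| SNil
| SExt (l : label) (a : sty) (r : srow).

Fixpoint sem (K : kind) : Set :=
  match K with
  | KType => sty
  | KRow => srow
  | KArr K1 K2 => sem K1 -> sem K2
  end.

Fixpoint sem_default (K : kind) : sem K :=
  match K with
  | KType => SBool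
  | KRow => SNil
  | KArr K1 K2 => fun _ => sem_default K2
  end.

(** Transparent, so that [get] computes at closed kinds: the equation of [TT CBool] with [TBool]
    then holds by conversion in the model. *)
Definition kind_eq_dec (K K' : kind) : {K = K'} + {K <> K'}.
Proof. decide equality. Defined.

Definition val : Set := {K : kind & sem K}.

Definition vkind (v : val) : kind := projT1 v.

(** Ill-kinded values are coerced to a default, which makes evaluation total
    and lets the substitution lemmas hold for raw constructors. *)
Definition get (K : kind) (v : val) : sem K :=
  match kind_eq_dec (projT1 v) K with
  | left E => eq_rect (projT1 v) sem (projT2 v) K E
  | right _ => sem_default K
  end.

Lemma get_existT K (x : sem K) : get K (existT sem K x) = x.
Proof.
  unfold get; simpl. destruct (kind_eq_dec K K) as [E|n]; [|congruence].
  now rewrite (UIP_dec kind_eq_dec E eq_refl).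
Qed.

Lemma get_existT_neq K K' (x : sem K) :
  K <> K' -> get K' (existT sem K x) = sem_default K'.
Proof.
  intros n; unfold get; simpl. now destruct (kind_eq_dec K K').
Qed.

Lemma existT_get K v : vkind v = K -> existT sem K (get K v) = v.
Proof.
  destruct v as [K' x]; simpl; intros <-. now rewrite get_existT.
Qed.

Lemma vkind_existT K v : vkind v = K -> exists x : sem K, v = existT sem K x.
Proof. destruct v as [K' x]; simpl; intros <-. now exists x. Qed.

(** * Interpretation of constructors *)

Section Typerec.
Variables (K : kind) (xB xI xS : sem K) (xL : sty -> sem K -> sem K)
  (xR : srow -> srow -> sem K) (xT : sty -> sem K -> sem K).

(** [Rmap] maps into [KType], so the [Record] rule of [Typerec] is well kinded
    only for [K = KType]; the [get] makes the semantic equation hold at every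
    [K]. *)
Fixpoint styrec (a : sty) : sem K :=
  match a with
  | SBool => xB
  | SInt => xI
  | SString => xS
  | SList a => xL a (styrec a)
  | SRecord r => xR r (srowrec r)
  | STrace a => xT a (styrec a)
  | SArr | SForall => sem_default K
  end
with srowrec (r : srow) : srow :=
  match r with
  | SNil => SNil
  | SExt l a r => SExt l (get KType (existT sem K (styrec a))) (srowrec r)
  end.

End Typerec.

Fixpoint srow_map (f : sty -> sty) (r : srow) : srow :=
  match r with
  | SNil => SNil
  | SExt l a r => SExt l (f a) (srow_map f r)
  end.

Definition vtype (a : sty) : val := existT sem KType a.
Definition vrow (r : srow) : val := existT sem KRow r.

(** The kind of the body is independent of the argument (see [vkind_eval]),
    so it may be read off at the default argument. *)
Definition vlam (K : kind) (b : sem K -> val) : val :=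
  existT sem (KArr K (vkind (b (sem_default K)))) (fun x => get _ (b x)).

Definition vapp (v w : val) : val :=
  match v with
  | existT _ K f =>
      match K return sem K -> val with
      | KArr K1 K2 => fun f => existT sem K2 (f (get K1 w))
      | _ => fun _ => vtype SBool
      end f
  end.

Definition vtyperec (v vB vI vS vL vR vT : val) : val :=
  let K := vkind vB in
  existT sem K
    (styrec K (get K vB) (get K vI) (get K vS)
       (get (KArr KType (KArr K K)) vL) (get (KArr KRow (KArr KRow K)) vR)
       (get (KArr KType (KArr K K)) vT) (get KType v)).

Fixpoint eval (e : nat -> val) (C : con) : val :=
  match C with
  | CVar a => e a
  | CBool => vtype SBool
  | CInt => vtype SInt
  | CString => vtype SString
  | CLam K C => vlam K (fun x => eval (scons (existT sem K x) e) C)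
  | CApp C D => vapp (eval e C) (eval e D)
  | CList C => vtype (SList (get KType (eval e C)))
  | CRecord R => vtype (SRecord (get KRow (eval e R)))
  | CTrace C => vtype (STrace (get KType (eval e C)))
  | CTyperec C CB CI CS CL CR CT =>
      vtyperec (eval e C) (eval e CB) (eval e CI) (eval e CS)
        (eval e CL) (eval e CR) (eval e CT)
  | CNil => vrow SNil
  | CExt l C R => vrow (SExt l (get KType (eval e C)) (get KRow (eval e R)))
  | CRmap C R =>
      vrow (srow_map (get (KArr KType KType) (eval e C)) (get KRow (eval e R)))
  end.

Lemma eval_ren C : forall xi e,
  eval e (con_ren xi C) = eval (fun n => e (xi n)) C.
Proof.
  induction C; intros xi e; simpl;
    rewrite ?IHC, ?IHC1, ?IHC2, ?IHC3, ?IHC4, ?IHC5, ?IHC6, ?IHC7; auto.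
  f_equal. extensionality x. rewrite IHC. f_equal.
  extensionality n. now destruct n.
Qed.

Lemma eval_shift v e C : eval (scons v e) (con_shift C) = eval e C.
Proof. unfold con_shift. rewrite eval_ren. reflexivity. Qed.

Lemma eval_subst C : forall s e,
  eval e (con_subst s C) = eval (fun n => eval e (s n)) C.
Proof.
  induction C; intros s e; simpl;
    rewrite ?IHC, ?IHC1, ?IHC2, ?IHC3, ?IHC4, ?IHC5, ?IHC6, ?IHC7; auto.
  f_equal. extensionality x. rewrite IHC. f_equal.
  extensionality n. destruct n as [|n]; simpl; [easy|apply eval_shift].
Qed.

Lemma eval_subst1 e C D : eval e (con_subst1 D C) = eval (scons (eval e D) e) C.
Proof.
  unfold con_subst1. rewrite eval_subst. f_equal.
  extensionality n. now destruct n.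
Qed.

Lemma vkind_vapp v w :
  vkind (vapp v w) = match vkind v with KArr _ K => K | _ => KType end.
Proof. now destruct v as [[| |K1 K2] f]. Qed.

(** An application takes its kind from the kind of its function and [vtyperec] from that of the
    [Bool] branch, never from the underlying values. *)
Lemma vkind_eval C : forall e e',
  (forall n, vkind (e n) = vkind (e' n)) ->
  vkind (eval e C) = vkind (eval e' C).
Proof.
  induction C; intros e e' He; simpl; auto.
  - f_equal. apply IHC. intros [|n]; simpl; auto.
  - rewrite !vkind_vapp. now rewrite (IHC1 e e' He).
Qed.

Lemma vapp_vlam K b w :
  (forall x y, vkind (b x) = vkind (b y)) -> vapp (vlam K b) w = b (get K w).
Proof. intros Hb. simpl. apply existT_get, Hb. Qed.

(** * Environments that respect a kind context *)

Definition models (e : nat -> val) (D : list kind) : Prop :=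
  forall a K, nth_error D a = Some K -> vkind (e a) = K.

Lemma models_scons e D K (x : sem K) :
  models e D -> models (scons (existT sem K x) e) (K :: D).
Proof. intros He [|a] K'; simpl; [congruence|apply He]. Qed.

(** Every kind is inhabited, so every context has a model. One model is enough to tell the heads of
    types apart, even for open terms. *)
Definition default_env (D : list kind) (a : nat) : val :=
  match nth_error D a with
  | Some K => existT sem K (sem_default K)
  | None => vtype SBool
  end.

Lemma models_default_env D : models (default_env D) D.
Proof. intros a K E. unfold default_env. now rewrite E. Qed.

Scheme con_kind_row_ind := Induction for con_kind Sort Prop
with row_kind_con_ind := Induction for row_kind Sort Prop.
Combined Scheme con_row_kind_ind from con_kind_row_ind, row_kind_con_ind.

Lemma eval_kind :
  (forall D C K, con_kind D C K -> forall e, models e D -> vkind (eval e C) = K) /\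
  (forall D S, row_kind D S -> forall e, models e D -> vkind (eval e S) = KRow).
Proof.
  apply con_row_kind_ind; intros; simpl; auto.
  - f_equal. auto using models_scons.
  - rewrite vkind_vapp. now rewrite (H e H1).
  - rewrite vkind_vapp. now rewrite (H e H1).
Qed.

Lemma con_eval_existT D C K e :
  con_kind D C K -> models e D -> exists x : sem K, eval e C = existT sem K x.
Proof. intros HC He. apply vkind_existT. eapply eval_kind; eauto. Qed.

Lemma row_eval_existT D S e :
  row_kind D S -> models e D -> exists r : sem KRow, eval e S = existT sem KRow r.
Proof. intros HS He. apply vkind_existT. eapply eval_kind; eauto. Qed.

(** * Soundness of constructor reduction and equivalence *)

Definition well_kinded (D : list kind) (C : con) : Prop :=
  (exists K, con_kind D C K) \/ row_kind D C.

(** Matches the recursion on rows with the [Rmap] in the reduct of [Typerec] on a record. For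
    [K <> KType] both sides put [SBool] in every field: on the right the mismatched function is
    coerced to the constant default. *)
Lemma srowrec_map K xB xI xS xL xR xT (r : srow) :
  srowrec K xB xI xS xL xR xT r =
  srow_map (get (KArr KType KType)
              (existT sem (KArr KType K) (styrec K xB xI xS xL xR xT))) r.
Proof.
  induction r as [|l a r IH]; simpl; [easy|].
  rewrite IH. f_equal.
  destruct (kind_eq_dec K KType) as [->|n].
  - now rewrite !get_existT.
  - rewrite !get_existT_neq by congruence. reflexivity.
Qed.

(** The kind of [D] makes the coercion of the argument in [vapp] the identity. *)
Lemma eval_beta e K C D :
  vkind (eval e D) = K ->
  eval e (CApp (CLam K C) D) = eval e (con_subst1 D C).
Proof.
  intros HD. rewrite eval_subst1. cbn [eval].
  rewrite vapp_vlam by (intros x y; apply vkind_eval; now intros [|n]).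
  now rewrite existT_get.
Qed.

(** A value of arrow kind is a set-theoretic function, so eta becomes function extensionality. *)
Lemma eval_eta e C K1 K2 :
  vkind (eval e C) = KArr K1 K2 ->
  eval e (CLam K1 (CApp (con_shift C) (CVar 0))) = eval e C.
Proof.
  intros HC. destruct (vkind_existT _ _ HC) as [f Hf].
  cbn [eval scons].
  assert (Hb : (fun x => vapp (eval (scons (existT sem K1 x) e) (con_shift C))
                           (existT sem K1 x)) = fun x => existT sem K2 (f x)).
  { extensionality x. rewrite eval_shift, Hf. simpl. now rewrite get_existT. }
  rewrite Hb, Hf. unfold vlam; simpl. f_equal.
  extensionality x. apply get_existT.
Qed.

(** The relation [con_step] serves constructors and rows alike, hence [well_kinded]. Kinding ensures
    that the coercions met in the redexes leave values unchanged. *)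
Lemma eval_step C C' :
  con_step C C' -> forall D e, well_kinded D C -> models e D -> eval e C = eval e C'.
Proof.
  induction 1; intros D0 e HC He;
    destruct HC as [[K0 HC]|HC]; inversion HC; subst; cbn [eval];
    try (erewrite IHcon_step; [reflexivity|unfold well_kinded; eauto|eauto]; fail).
  (* Beta occurs twice: the argument is a constructor or a row. *)
  1,2: match goal with H : con_kind _ (CLam _ _) _ |- _ => inversion H; subst end;
    apply eval_beta; eapply eval_kind; eauto.
  - reflexivity.
  - match goal with H : row_kind _ (CExt _ _ _) |- _ => inversion H; subst end.
    match goal with H : con_kind _ C _ |- _ =>
      destruct (con_eval_existT _ _ _ _ H He) as [f Hf] end.
    rewrite Hf. simpl. now rewrite !get_existT.
  - apply existT_get; reflexivity.
  (* The result kind is read off the [Bool] branch; kinding gives the [Int] branch the same kind. *)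
  - unfold vtyperec; simpl.
    match goal with HB : con_kind _ CB _, HI : con_kind _ CI _ |- _ =>
      rewrite (proj1 eval_kind _ _ _ HB e He);
      apply existT_get; exact (proj1 eval_kind _ _ _ HI e He) end.
  - unfold vtyperec; simpl.
    match goal with HB : con_kind _ CB _, HI : con_kind _ CS _ |- _ =>
      rewrite (proj1 eval_kind _ _ _ HB e He);
      apply existT_get; exact (proj1 eval_kind _ _ _ HI e He) end.
  - match goal with HL : con_kind _ CL _, HB : con_kind _ CB _ |- _ =>
      destruct (con_eval_existT _ _ _ _ HL He) as [f Hf];
      destruct (con_eval_existT _ _ _ _ HB He) as [xB HxB] end.
    rewrite Hf, HxB. unfold vtyperec; simpl. now rewrite !get_existT.
  - match goal with HR : con_kind _ CR _, HB : con_kind _ CB _ |- _ =>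
      destruct (con_eval_existT _ _ _ _ HR He) as [f Hf];
      destruct (con_eval_existT _ _ _ _ HB He) as [xB HxB] end.
    (* The function mapped over the row in the reduct denotes [styrec] itself, as the shifted
       branches ignore the bound variable. *)
    assert (Hrec : vlam KType (fun x : sem KType => eval (scons (existT sem KType x) e)
       (CTyperec (CVar 0) (con_shift CB) (con_shift CI) (con_shift CS)
                  (con_shift CL) (con_shift CR) (con_shift CT))) =
      existT sem (KArr KType K0) (styrec K0 xB (get K0 (eval e CI))
        (get K0 (eval e CS)) (get (KArr KType (KArr K0 K0)) (eval e CL)) f
        (get (KArr KType (KArr K0 K0)) (eval e CT)))).
    { cbn [eval]. unfold vlam. cbn [scons]. rewrite !eval_shift, HxB. simpl.
      f_equal. extensionality x. rewrite !eval_shift, HxB, Hf. unfold vtyperec.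
      simpl. now rewrite !get_existT. }
    cbn [eval] in Hrec. rewrite Hrec, Hf, HxB. unfold vtyperec; simpl.
    rewrite !get_existT. f_equal. f_equal. apply srowrec_map.
  - match goal with HL : con_kind _ CT _, HB : con_kind _ CB _ |- _ =>
      destruct (con_eval_existT _ _ _ _ HL He) as [f Hf];
      destruct (con_eval_existT _ _ _ _ HB He) as [xB HxB] end.
    rewrite Hf, HxB. unfold vtyperec; simpl. now rewrite !get_existT.
  - f_equal. extensionality x.
    eapply IHcon_step; [left; eauto|now apply models_scons].
Qed.

Scheme con_eq_row_ind := Induction for con_eq Sort Prop
with row_eq_con_ind := Induction for row_eq Sort Prop.
Combined Scheme con_row_eq_ind from con_eq_row_ind, row_eq_con_ind.

Lemma eval_eq :
  (forall D C C' K, con_eq D C C' K ->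
     forall e, models e D -> eval e C = eval e C') /\
  (forall D S S', row_eq D S S' ->
     forall e, models e D -> eval e S = eval e S').
Proof.
  apply con_row_eq_ind; intros; auto.
  - symmetry; auto.
  - rewrite (H e); auto.
  - eapply eval_step; [eassumption|left; eauto|assumption].
  - eapply eval_eta, eval_kind; eauto.
  - cbn [eval]. f_equal. extensionality x. auto using models_scons.
  - cbn [eval]. now rewrite (H e), (H0 e).
  - cbn [eval]. now rewrite (H e), (H0 e).
  - cbn [eval]. now rewrite (H e).
  - cbn [eval]. now rewrite (H e).
  - cbn [eval]. now rewrite (H e).
  - cbn [eval]. now rewrite (H e), (H0 e), (H1 e), (H2 e), (H3 e), (H4 e), (H5 e).
  - symmetry; auto.
  - rewrite (H e); auto.
  - eapply eval_step; [eassumption|right; eauto|assumption].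
  - cbn [eval]. now rewrite (H e), (H0 e).
  - cbn [eval]. now rewrite (H e), (H0 e).
Qed.

(** * Interpretation of types and canonical forms *)

Fixpoint ty_eval (e : nat -> val) (A : ty) : sty :=
  match A with
  | TT C => get KType (eval e C)
  | TBool => SBool
  | TInt => SInt
  | TString => SString
  | TArr _ _ => SArr
  | TList A => SList (ty_eval e A)
  | TRecord R => SRecord (rty_eval e R)
  | TTrace A => STrace (ty_eval e A)
  | TForall _ _ => SForall
  end
with rty_eval (e : nat -> val) (R : rty) : srow :=
  match R with
  | RNil => SNil
  | RExt l A R => SExt l (ty_eval e A) (rty_eval e R)
  | RT S0 => get KRow (eval e S0)
  end.

Scheme ty_eq_rty_ind := Induction for ty_eq Sort Prop
with rty_eq_ty_ind := Induction for rty_eq Sort Prop.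
Combined Scheme ty_rty_eq_ind from ty_eq_rty_ind, rty_eq_ty_ind.

Lemma ty_eval_eq :
  (forall D A B, ty_eq D A B ->
     forall e, models e D -> ty_eval e A = ty_eval e B) /\
  (forall D R R', rty_eq D R R' ->
     forall e, models e D -> rty_eval e R = rty_eval e R').
Proof.
  apply ty_rty_eq_ind; intros; simpl; auto; try (f_equal; auto; fail);
    try (symmetry; auto; fail); try (rewrite (H e); auto; fail).
  - erewrite (proj1 eval_eq); eauto.
  - erewrite (proj2 eval_eq); eauto.
Qed.

(** The head that the outermost former of [M] forces on its type, stated in the model so that
    conversion is invisible. The first label of a record is kept for the sake of projection. *)
Definition canonical (M : tm) (a : sty) : Prop :=
  match M with
  | MConst (KBool _) | MEq _ _ => a = SBool
  | MConst (KInt _) | MPlus _ _ => a = SInt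
  | MConst (KString _) => a = SString
  | MLam _ _ => a = SArr
  | MTLam _ _ => a = SForall
  | MUnit => a = SRecord SNil
  | MExt l _ _ => exists b r, a = SRecord (SExt l b r)
  | MNil | MSing _ | MAppend _ _ | MFor _ _ | MTable _ _ => exists b, a = SList b
  | MLit _ | MTrIf _ | MTrFor _ _ | MCell _ | MOpEq _ _ | MOpPlus _ =>
      exists b, a = STrace b
  | _ => True
  end.

(** Conversion preserves [ty_eval]; any other last rule displays the head that [canonical] asks
    for. *)
Lemma has_type_canonical D G M A e :
  has_type D G M A -> models e D -> canonical M (ty_eval e A).
Proof.
  induction 1; intros He; simpl; eauto.
  - now destruct c.
  - rewrite (proj1 ty_eval_eq _ _ _ H0 e He). auto.
Qed.

(** * Progress for constructors and rows *)

Lemma con_row_progress :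
  (forall D C K, con_kind D C K -> con_nf C \/ exists C', con_step C C') /\
  (forall D S, row_kind D S -> row_nf S \/ exists S', con_step S S').
Proof.
  apply con_row_kind_ind; intros; repeat match goal with
    | H : _ \/ (exists C', con_step _ C') |- _ =>
        destruct H as [H|[? H]];
        [|right; eexists; constructor; eassumption; fail]
    end; auto using con_nf, con_ne, row_nf, row_ne.
  (* Kinds have no equational theory, so inverting the kinding excludes normal forms of the wrong
     shape; the others are neutral or form a redex. *)
  - inversion H; subst; auto using con_nf, con_ne;
      try solve [inversion c]. right; eexists; constructor.
  - inversion H; subst; auto using con_nf, con_ne;
      try solve [inversion c]. right; eexists; constructor.
  - inversion H; subst; auto using con_nf, con_ne;
      try solve [inversion c]; right; eexists; constructor.
  - inversion H0; subst; auto using row_nf, row_ne; right; eexists; constructor.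
Qed.

Lemma con_progress D C K :
  con_kind D C K -> con_nf C \/ exists C', con_step C C'.
Proof. apply con_row_progress. Qed.

Lemma row_progress D S : row_kind D S -> row_nf S \/ exists S', con_step S S'.
Proof. apply con_row_progress. Qed.

(** A normal row ends in [CNil] or in a neutral tail, and neutrality passes from the tail to the
    whole row. So [MRfold] and [MRmap] either fire or are neutral. *)
Lemma row_nf_cases S :
  row_nf S -> row_ne S \/ exists fs, S = closed_row fs.
Proof.
  induction 1 as [U HU| |l C S HC HS IH]; auto.
  - right; now exists nil.
  - destruct IH as [HU|[fs ->]].
    + left; now constructor.
    + right; now exists ((l, C) :: fs)%list.
Qed.

(** * Progress for terms *)

Ltac solve_elim Hc :=
  (* An eliminator applied to a normal form is normal, is a redex, or contradicts the canonical form
     [Hc]. *)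
  first
    [ solve [auto using normal, neutral]
    | solve [right; eexists; constructor]
    | exfalso; repeat match type of Hc with ex _ => destruct Hc as [? Hc] end;
      try match type of Hc with context [match ?c with _ => _ end] => destruct c end;
      discriminate Hc ].

Theorem lemma18 (D : list kind) (G : list ty) (M : tm) (A : ty)
  (wfG : wf_ctx D G) (typM : has_type D G M A) :
  normal M \/ exists M' : tm, step M M'.
Proof.
  clear wfG.
  (* Steps of immediate subterms and constructors lift by congruence, so what remains has these
     normal; a stepping body of [MFix] is covered by unfolding. *)
  induction typM; repeat match goal with
    | H : _ \/ (exists M', step _ M') |- _ =>
        destruct H as [H|[? H]];
        [|right; eexists; constructor; eassumption; fail]
    | H : con_kind _ ?C _ |- _ =>
        match goal with | |- context [C] => idtac end;
        destruct (con_progress _ _ _ H) as [?|[? ?]];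
        [revert H|right; eexists; constructor; eassumption; fail]
    | H : row_kind _ ?C |- _ =>
        match goal with | |- context [C] => idtac end;
        destruct (row_progress _ _ H) as [?|[? ?]];
        [revert H|right; eexists; constructor; eassumption; fail]
    end; intros; auto using normal, neutral.
  all: pose proof (models_default_env D) as He.
  - pose proof (has_type_canonical _ _ _ _ _ typM1 He) as Hc.
    destruct IHtypM1; simpl in Hc; solve_elim Hc.
  - assert (HC : (con_nf C \/ row_nf C) \/ exists C', con_step C C').
    { destruct H as [HC|[_ HC]];
        [destruct (con_progress _ _ _ HC)|destruct (row_progress _ _ HC)]; auto. }
    destruct HC as [HC|[C' HC]]; [|right; eexists; constructor; eassumption].
    pose proof (has_type_canonical _ _ _ _ _ typM He) as Hc.
    destruct IHtypM; simpl in Hc; try solve_elim Hc.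
    left. constructor. destruct HC; auto using neutral.
  - right. eexists. constructor.
  - pose proof (has_type_canonical _ _ _ _ _ typM1 He) as Hc.
    destruct IHtypM1; simpl in Hc; auto using normal, nf_cond; try solve_elim Hc.
    destruct c as [[|]| |]; solve_elim Hc.
  - pose proof (has_type_canonical _ _ _ _ _ typM He) as Hc.
    destruct IHtypM; simpl in Hc; try solve_elim Hc.
    + left. auto using normal, neutral, nf_proj.
    (* Typing projects only the first label of a row, and [E] equates it with the label of the
       extension; the field sought is the outermost one. *)
    + destruct Hc as (b & r & E). injection E as <- _ _.
      right. eexists. apply st_proj, has_field_here.
  - pose proof (has_type_canonical _ _ _ _ _ typM1 He) as Hc.
    destruct IHtypM1; simpl in Hc; auto using normal, nf_source; solve_elim Hc.
  - destruct (row_nf_cases S) as [HU|[fs ->]]; auto using normal, neutral.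
    right. eexists. constructor.
  - destruct (row_nf_cases S) as [HU|[fs ->]]; auto using normal, neutral.
    right. eexists. constructor.
  - match goal with HC : con_nf C |- _ => destruct HC end;
      auto using normal, neutral;
      try match goal with HC : con_kind _ (CLam _ _) KType |- _ => inversion HC end;
      right; eexists; constructor.
  - pose proof (has_type_canonical _ _ _ _ _ typM1 He) as Hc.
    destruct IHtypM1; simpl in Hc; solve_elim Hc.
Qed.
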